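(* Let $(\Omega,\Sigma,\mu)$ be a measure space, $\rho:\Omega\to(0,\infty)$ measurable, $M>m>0$, and let $f,g,h\in L^2_\rho(\Omega)$ with $h(x)\neq 0$ for a.e. $x\in\Omega$, be such that the functions $$M\cdot\frac{g}{h}-\frac{f}{h},\qquad \frac{f}{h}-m\cdot\frac{g}{h}$$ are synchronous on $\Omega$. For $u,v\in L^2_\rho(\Omega)$ write $$\Gamma(u,v):=\det\begin{pmatrix}\int_\Omega\rho uv\,d\mu & \int_\Omega\rho uh\,d\mu\\ \int_\Omega\rho vh\,d\mu & \int_\Omega\rho h^2\,d\mu\end{pmatrix}.$$ Then $$0\le \Gamma(f,f)^{1/2}\,\Gamma(g,g)^{1/2}-|\Gamma(f,g)|\le \frac14\,\frac{(M-m)^2}{M+m}\,\Gamma(g,g).$$ The constant $\frac14$ is best possible: for every real $D<\frac14$ there exist a measure space $(\Omega,\Sigma,\mu)$, a measurable $\rho:\Omega\to(0,\infty)$, numbers $M>m>0$ and functions $f,g,h\in L^2_\rho(\Omega)$ with $h(x)\neq 0$ for a.e. $x\in\Omega$ and with $M\cdot\frac{g}{h}-\frac{f}{h}$ and $\frac{f}{h}-m\cdot\frac{g}{h}$ synchronous on $\Omega$, for which $\Gamma(f,f)^{1/2}\,\Gamma(g,g)^{1/2}-|\Gamma(f,g)|> D\,\frac{(M-m)^2}{M+m}\,\Gamma(g,g)$.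
   Context: $(\Omega,\Sigma,\mu)$ consists of a set $\Omega$, a $\sigma$-algebra $\Sigma$ of subsets of $\Omega$ and a countably additive positive measure $\mu$ on $\Sigma$ with values in $\mathbb{R}\cup\{\infty\}$. For measurable $\rho:\Omega\to(0,\infty)$, $L^2_\rho(\Omega)$ is the Hilbert space of real-valued measurable functions $f$ on $\Omega$ with $\int_\Omega\rho(s)|f(s)|^2\,d\mu(s)<\infty$. A pair of real-valued functions $(q,p)$ on $\Omega$ is synchronous if $(q(x)-q(y))(p(x)-p(y))\ge 0$ for a.e. $x,y\in\Omega$. *)

(* Defs.v *)
From mathcomp Require Export all_boot all_order all_algebra.
From mathcomp Require Export all_classical all_reals all_analysis.

Set Implicit Arguments.
Unset Strict Implicit.
Unset Printing Implicit Defensive.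

Import Order.TTheory GRing.Theory Num.Theory.

Local Open Scope classical_set_scope.
Local Open Scope ring_scope.

(* Membership of a function (not of an a.e.-equivalence class) in
   L^2_rho(Omega). *)
Definition in_L2 d (T : measurableType d) (R : realType)
    (mu : {measure set T -> \bar R}) (rho f : T -> R) : Prop :=
  measurable_fun setT f /\
  (\int[mu]_x (rho x * `|f x| ^+ 2)%:E < +oo)%E.

(* "For a.e. x, y" is read as an iterated quantifier, which makes sense without
   sigma-finiteness of mu.  When q and p are measurable it is equivalent to the
   existence of a mu-null set outside which the inequality holds for all x and
   y and, for sigma-finite mu, to "(mu \x mu)-almost everywhere". *)
Definition synchronous d (T : measurableType d) (R : realType)
    (mu : {measure set T -> \bar R}) (q p : T -> R) : Prop :=
  \forall x \ae mu, \forall y \ae mu, 0 <= (q x - q y) * (p x - p y).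

Definition Gamma d (T : measurableType d) (R : realType)
    (mu : {measure set T -> \bar R}) (rho h u v : T -> R) : R :=
  \det (block_mx
    (\int[mu]_x (rho x * u x * v x))%:M (\int[mu]_x (rho x * u x * h x))%:M
    (\int[mu]_x (rho x * v x * h x))%:M (\int[mu]_x (rho x * h x ^+ 2))%:M
    : 'M[R]_(1 + 1)).

(* Main.v *)
Require Import Defs.
From mathcomp Require Import measurable_realfun ring lra.

(** Gamma is a positive semidefinite symmetric bilinear form, and synchronicity
    gives [Gamma (M g - f, f - m g) >= 0], that is
    [Gamma(f, f) + m M Gamma(g, g) <= (M + m) Gamma(f, g)].  Writing
    [a^2 = Gamma(f, f)], [b^2 = Gamma(g, g)], the upper bound is then
    [(a - (M + m) b / 2)^2 >= 0].

    Equality would force [a = (M + m) b / 2] and [Gamma (M g - f, f - m g) = 0].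
    The latter is approached by taking [M g - f] and [f - m g] proportional to
    [1_A] and [- 1_B], for disjoint sets A and B whose measure is negligible
    compared to that of the whole space; the former then fixes the ratio of the
    two coefficients in terms of m and M. *)

Set Implicit Arguments.
Unset Strict Implicit.
Unset Printing Implicit Defensive.

Import Order.TTheory GRing.Theory Num.Theory.

Local Open Scope classical_set_scope.
Local Open Scope ring_scope.

Lemma det_block_scalar_mx11 (R : comNzRingType) (a b c e : R) :
  \det (block_mx a%:M b%:M c%:M e%:M : 'M[R]_(1 + 1)) = a * e - b * c.
Proof.
have s0 : fintype.split (ord0 : 'I_(1 + 1)) = inl 0.
  by rewrite -(unsplitK (inl 0)); congr fintype.split; exact: val_inj.
have s1 : fintype.split (lift ord0 ord0 : 'I_(1 + 1)) = inr 0.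
  by rewrite -(unsplitK (inr 0)); congr fintype.split; exact: val_inj.
have s10 : lift (lift ord0 ord0 : 'I_(1 + 1)) 0 = ord0 by exact: val_inj.
rewrite (expand_det_row _ ord0) !big_ord_recl big_ord0 /cofactor !det_mx11.
by rewrite !mxE s10 !s0 !s1 !mxE s0 s1 !mxE /=; ring.
Qed.

(** * Weighted inner products and the form [Gamma] *)

Section WeightedL2.
Context d (T : measurableType d) (R : realType).
Context (mu : {measure set T -> \bar R}) (rho : T -> R).

Definition wdot (u v : T -> R) : R := \int[mu]_x (rho x * u x * v x).

Lemma wdotC u v : wdot u v = wdot v u.
Proof. by apply: eq_Rintegral => x _; rewrite mulrAC. Qed.

Lemma GammaE h u v :
  Gamma mu rho h u v = wdot u v * wdot h h - wdot u h * wdot v h.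
Proof.
rewrite /Gamma det_block_scalar_mx11; congr (_ * _ - _).
by apply: eq_Rintegral => x _; rewrite expr2 mulrA.
Qed.

(** [F] agrees almost everywhere with its absolute value; should that integral be infinite, [fine]
    returns 0. *)
Lemma Rintegral_ae_ge0 (F : T -> R) : measurable_fun setT F ->
  (\forall x \ae mu, 0 <= F x) -> 0 <= \int[mu]_x F x.
Proof.
move=> mF F_ge0.
have -> : \int[mu]_x F x = \int[mu]_x `|F x|.
  congr fine; apply: ae_eq_integral => //.
  - exact/measurable_EFinP.
  - by apply/measurable_EFinP; exact: measurableT_comp.
  - by apply: filterS F_ge0 => x Fx _; rewrite ger0_norm.
by apply: Rintegral_ge0.
Qed.

Hypothesis mrho : measurable_fun setT rho.
Hypothesis rho_gt0 : forall x, 0 < rho x.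

Lemma integrable_wsq u : in_L2 mu rho u ->
  mu.-integrable setT (EFin \o (fun x => rho x * `|u x| ^+ 2)).
Proof.
move=> [mu_u u_fin]; apply/integrableP; split.
  apply/measurable_EFinP; apply: measurable_funM => //.
  by apply: measurable_funX; exact: measurableT_comp.
rewrite (eq_integral (fun x => (rho x * `|u x| ^+ 2)%:E)) // => x _ /=.
by rewrite ger0_norm // mulr_ge0 ?exprn_ge0 // ltW.
Qed.

(** Domination by [|u v| <= u^2 + v^2]. *)
Lemma integrable_wdot u v : in_L2 mu rho u -> in_L2 mu rho v ->
  mu.-integrable setT (EFin \o (fun x => rho x * u x * v x)).
Proof.
move=> uL vL.
have int_sum := integrableD measurableT (integrable_wsq uL) (integrable_wsq vL).
apply: (le_integrable measurableT) int_sum => [|x _].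
  apply/measurable_EFinP; apply: measurable_funM; last exact: vL.1.
  by apply: measurable_funM => //; exact: uL.1.
have rho_ge0 := ltW (rho_gt0 x).
rewrite /= lee_fin -mulrDr -mulrA !normrM [X in _ <= _ * X]ger0_norm; last first.
  by rewrite addr_ge0 ?exprn_ge0.
rewrite ler_wpM2l //.
have := sqr_ge0 (`|u x| - `|v x|); have := normr_ge0 (u x).
by have := normr_ge0 (v x); nra.
Qed.

(** Domination by [(a u + b v)^2 <= 2 a^2 u^2 + 2 b^2 v^2]. *)
Lemma in_L2_lin (a b : R) u v : in_L2 mu rho u -> in_L2 mu rho v ->
  in_L2 mu rho (fun x => a * u x + b * v x).
Proof.
move=> uL vL.
have mw : measurable_fun setT (fun x => a * u x + b * v x).
  by apply: measurable_funD; apply: measurable_funM => //;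
    [exact: uL.1 | exact: vL.1].
split=> //.
have int_sum := integrableD measurableT
  (integrableZl measurableT (2 * a ^+ 2) (integrable_wsq uL))
  (integrableZl measurableT (2 * b ^+ 2) (integrable_wsq vL)).
apply: le_lt_trans (integrable_lty measurableT int_sum).
apply: ge0_le_integral => //.
- by move=> x _; rewrite lee_fin mulr_ge0 ?exprn_ge0 // ltW.
- apply/measurable_EFinP; apply: measurable_funM => //.
  by apply: measurable_funX; exact: measurableT_comp.
- exact: measurable_int int_sum.
move=> x _; rewrite /= lee_fin -!normrX !ger0_norm ?sqr_ge0 //.
have := sqr_ge0 (a * u x - b * v x); have := rho_gt0 x; nra.
Qed.

Lemma wdot_linl (a b : R) u v w :
  in_L2 mu rho u -> in_L2 mu rho v -> in_L2 mu rho w ->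
  wdot (fun x => a * u x + b * v x) w = a * wdot u w + b * wdot v w.
Proof.
move=> uL vL wL; have iu := integrable_wdot uL wL.
have iv := integrable_wdot vL wL.
rewrite /wdot -!RintegralZl // -RintegralD //; last 2 first.
- exact: (integrableZl measurableT a iu).
- exact: (integrableZl measurableT b iv).
by apply: eq_Rintegral => x _; ring.
Qed.

Lemma wdot_linr (a b : R) u v w :
  in_L2 mu rho u -> in_L2 mu rho v -> in_L2 mu rho w ->
  wdot w (fun x => a * u x + b * v x) = a * wdot w u + b * wdot w v.
Proof. by move=> uL vL wL; rewrite wdotC wdot_linl // !(wdotC w). Qed.

Lemma GammaC h u v : Gamma mu rho h u v = Gamma mu rho h v u.
Proof. by rewrite !GammaE wdotC [X in _ - X]mulrC. Qed.

Lemma Gamma_linl (a b : R) h u v w : in_L2 mu rho h ->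
  in_L2 mu rho u -> in_L2 mu rho v -> in_L2 mu rho w ->
  Gamma mu rho h (fun x => a * u x + b * v x) w =
    a * Gamma mu rho h u w + b * Gamma mu rho h v w.
Proof.
move=> hL uL vL wL; rewrite !GammaE.
by rewrite wdot_linl // wdot_linl //; ring.
Qed.

Lemma Gamma_linr (a b : R) h u v w : in_L2 mu rho h ->
  in_L2 mu rho u -> in_L2 mu rho v -> in_L2 mu rho w ->
  Gamma mu rho h w (fun x => a * u x + b * v x) =
    a * Gamma mu rho h w u + b * Gamma mu rho h w v.
Proof.
move=> hL uL vL wL; rewrite GammaC.
by rewrite (Gamma_linl a b hL uL vL wL) (GammaC h u) (GammaC h v).
Qed.

(* Korkine's identity: Gamma(u, v) is half the double integral of
   rho(x) rho(y) (u(x) h(y) - h(x) u(y)) (v(x) h(y) - h(x) v(y)), which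
   synchronicity makes nonnegative.  Both integrations are carried out by
   linearity, so that Fubini's theorem and sigma-finiteness are avoided. *)
Lemma Gamma_synchronous_ge0 h u v :
  in_L2 mu rho h -> in_L2 mu rho u -> in_L2 mu rho v ->
  (\forall x \ae mu, h x != 0) ->
  synchronous mu (fun x => u x / h x) (fun x => v x / h x) ->
  0 <= Gamma mu rho h u v.
Proof.
move=> hL uL vL h_neq0 sync.
pose H := wdot h h; pose U := wdot u h; pose V := wdot v h; pose W := wdot u v.
(* [K x] is the inner integral over y at fixed x, already expanded. In this grouping it is a sum of
   two [wdot] integrands, and it integrates to [2 (W H - U V)]. *)
pose K x := rho x * u x * (H * v x + - V * h x)
  + rho x * h x * (W * h x + - U * v x).
have wL : in_L2 mu rho (fun x => H * v x + - V * h x) by exact: in_L2_lin.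
have zL : in_L2 mu rho (fun x => W * h x + - U * v x) by exact: in_L2_lin.
have iw := integrable_wdot uL wL; have iz := integrable_wdot hL zL.
suff K_ge0 : \forall x \ae mu, 0 <= K x.
  have : 0 <= \int[mu]_x K x.
    apply: (Rintegral_ae_ge0 _ K_ge0); apply/measurable_EFinP.
    exact: measurable_int (integrableD measurableT iw iz).
  rewrite RintegralD // -!/(wdot _ _) !wdot_linr // GammaE.
  by rewrite (wdotC h v) -/H -/U -/V -/W; lra.
near=> x.
have hx : h x != 0 by near: x.
have /= sync_x : \forall y \ae mu,
  0 <= (u x / h x - u y / h y) * (v x / h x - v y / h y) by near: x.
have uxL : in_L2 mu rho (fun y => u x * h y + - h x * u y) by exact: in_L2_lin.
have vxL : in_L2 mu rho (fun y => v x * h y + - h x * v y) by exact: in_L2_lin.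
have -> : K x = rho x * wdot (fun y => u x * h y + - h x * u y)
    (fun y => v x * h y + - h x * v y).
  rewrite wdot_linl // !wdot_linr // (wdotC h v) -/H -/U -/V -/W /K; ring.
rewrite pmulr_rge0 // /wdot; apply: Rintegral_ae_ge0.
  by apply/measurable_EFinP; exact: measurable_int (integrable_wdot uxL vxL).
apply: (filterS2 _ _ sync_x h_neq0) => y sync_xy hy.
rewrite -mulrA pmulr_rge0 //.
(* Factoring out [h x * h y] from both factors leaves the product in the synchronicity
   hypothesis. *)
suff -> : (u x * h y + - h x * u y) * (v x * h y + - h x * v y) =
    (h x * h y) ^+ 2 * ((u x / h x - u y / h y) * (v x / h x - v y / h y)).
  by rewrite mulr_ge0 ?sqr_ge0.
by field; rewrite hx hy.
Unshelve. all: by end_near. Qed.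

(** Every function is synchronous with itself. *)
Lemma Gamma_ge0 h u : in_L2 mu rho h -> in_L2 mu rho u ->
  (\forall x \ae mu, h x != 0) -> 0 <= Gamma mu rho h u u.
Proof.
move=> hL uL h_neq0; apply: Gamma_synchronous_ge0 => //.
by apply: aeW => x; apply: aeW => y; rewrite -expr2 sqr_ge0.
Qed.

Lemma Gamma_CauchySchwarz h u v :
  in_L2 mu rho h -> in_L2 mu rho u -> in_L2 mu rho v ->
  (\forall x \ae mu, h x != 0) ->
  Gamma mu rho h u v ^+ 2 <= Gamma mu rho h u u * Gamma mu rho h v v.
Proof.
move=> hL uL vL h_neq0.
have q_ge0 (s t : R) : 0 <= s ^+ 2 * Gamma mu rho h u u
    + 2 * (s * t) * Gamma mu rho h u v + t ^+ 2 * Gamma mu rho h v v.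
  have wL : in_L2 mu rho (fun x => s * u x + t * v x) by exact: in_L2_lin.
  have := Gamma_ge0 hL wL h_neq0.
  rewrite (Gamma_linl s t hL uL vL wL) !(Gamma_linr s t hL uL vL) //.
  rewrite (GammaC h v u).
  move: (Gamma _ _ _ u u) (Gamma _ _ _ u v) (Gamma _ _ _ v v) => A C B; lra.
have A_ge0 := Gamma_ge0 hL uL h_neq0.
have B_ge0 := Gamma_ge0 hL vL h_neq0.
move: (Gamma mu rho h u u) (Gamma mu rho h v v) (Gamma mu rho h u v)
  A_ge0 B_ge0 q_ge0 => A B C A_ge0 B_ge0 q_ge0.
have [B_eq0 | B_neq0] := eqVneq B 0.
  (* For [B = 0] the form takes the value [- C^2 (A + 2)] here, so [C = 0]. *)
  by have := q_ge0 C (- (1 + A)); rewrite B_eq0; nra.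
have B_gt0 : 0 < B by rewrite lt_neqAle eq_sym B_neq0.
(* At [(B, - C)] the form equals [B (A B - C^2)]. *)
rewrite -subr_ge0 -(pmulr_rge0 _ B_gt0); have := q_ge0 B (- C); lra.
Qed.

End WeightedL2.

Lemma sqrt_prod_sub_bounds (R : rcfType) (A B C m M : R) :
  0 < m -> m < M -> 0 <= A -> 0 <= B -> C ^+ 2 <= A * B ->
  A + m * M * B <= (M + m) * C ->
  0 <= Num.sqrt A * Num.sqrt B - `|C|
    <= 4^-1 * ((M - m) ^+ 2 / (M + m)) * B.
Proof.
move=> m0 mM A0 B0 CS le_C.
have s_gt0 : 0 < M + m by lra.
have C_ge0 : 0 <= C.
  rewrite -(pmulr_rge0 _ s_gt0); apply: le_trans le_C.
  by rewrite addr_ge0 // !mulr_ge0 //; lra.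
rewrite ger0_norm //; apply/andP; split.
  rewrite subr_ge0 -sqrtrM // -(ger0_norm C_ge0) -sqrtr_sqr.
  exact: ler_wsqrtr.
have -> : 4^-1 * ((M - m) ^+ 2 / (M + m)) * B =
    ((M - m) ^+ 2 / 4 * B) / (M + m) by field; lra.
rewrite ler_pdivlMr //.
rewrite -{2}(sqr_sqrtr B0).
move: le_C; rewrite -{1}(sqr_sqrtr B0) -{1}(sqr_sqrtr A0).
(* The square is completed using [(M + m)^2 / 4 - m M = (M - m)^2 / 4]. *)
have := sqr_ge0 (Num.sqrt A - (M + m) / 2 * Num.sqrt B).
lra.
Qed.

(** * A discrete measure for the sharpness of the constant *)

Section ThreeAtoms.
Variable R : realType.

(** Unit masses are enough, as the weight [rho] will supply unequal ones. On [nat] every function is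
    measurable. *)
Definition three_atoms : {measure set nat -> \bar R} :=
  measure_add \d_0%N (measure_add \d_1%N \d_2%N).

Lemma integral_three_atoms (F : nat -> R) :
  (\int[three_atoms]_x (F x)%:E)%E = (F 0%N + F 1%N + F 2%N)%:E.
Proof.
have mF : measurable_fun setT (EFin \o F) by [].
have int_dirac n :
    (\d_n : {measure set nat -> \bar R}).-integrable setT (EFin \o F).
  apply/integrableP; split => //.
  by rewrite integral_dirac //= diracT mul1e ltry.
have int_add : (measure_add \d_1%N \d_2%N :
    {measure set nat -> \bar R}).-integrable setT (EFin \o F).
  apply/integrableP; split => //.
  by rewrite ge0_integral_measure_add // !integral_dirac //= !diracT !mul1e ltry.
rewrite integral_measure_add // integral_measure_add //.
by rewrite !integral_dirac //= !diracT !mul1e -!EFinD addrA.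
Qed.

Lemma Rintegral_three_atoms (F : nat -> R) :
  \int[three_atoms]_x F x = F 0%N + F 1%N + F 2%N.
Proof. by rewrite /Rintegral integral_three_atoms. Qed.

Lemma in_L2_three_atoms (rho f : nat -> R) : in_L2 three_atoms rho f.
Proof. by split => //; rewrite integral_three_atoms ltry. Qed.

End ThreeAtoms.

Theorem proposition3 (R : realType) :
  (forall (d : measure_display) (T : measurableType d)
      (mu : {measure set T -> \bar R}) (rho : T -> R) (m M : R)
      (f g h : T -> R),
    measurable_fun setT rho -> (forall x, 0 < rho x) ->
    0 < m -> m < M ->
    in_L2 mu rho f -> in_L2 mu rho g -> in_L2 mu rho h ->
    (\forall x \ae mu, h x != 0) ->
    synchronous mu (fun x => M * (g x / h x) - f x / h x)
                   (fun x => f x / h x - m * (g x / h x)) ->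
    0 <= Num.sqrt (Gamma mu rho h f f) * Num.sqrt (Gamma mu rho h g g)
         - `|Gamma mu rho h f g|
      <= 4^-1 * ((M - m) ^+ 2 / (M + m)) * Gamma mu rho h g g)
  /\
  (forall D : R, D < 4^-1 ->
    exists (d : measure_display) (T : measurableType d)
      (mu : {measure set T -> \bar R}) (rho : T -> R) (m M : R)
      (f g h : T -> R),
      (measurable_fun setT rho /\ (forall x, 0 < rho x)) /\
      (0 < m /\ m < M) /\
      (in_L2 mu rho f /\ in_L2 mu rho g /\ in_L2 mu rho h) /\
      (\forall x \ae mu, h x != 0) /\
      synchronous mu (fun x => M * (g x / h x) - f x / h x)
                     (fun x => f x / h x - m * (g x / h x)) /\
      D * ((M - m) ^+ 2 / (M + m)) * Gamma mu rho h g g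
        < Num.sqrt (Gamma mu rho h f f) * Num.sqrt (Gamma mu rho h g g)
          - `|Gamma mu rho h f g|).
Proof.
split=> [d T mu rho m M f g h mrho rho_gt0 m0 mM fL gL hL h_neq0 sync|D D_lt].
  apply: sqrt_prod_sub_bounds => //; try exact: Gamma_ge0.
    exact: Gamma_CauchySchwarz.
  have uL : in_L2 mu rho (fun x => M * g x + -1 * f x) by exact: in_L2_lin.
  have vL : in_L2 mu rho (fun x => 1 * f x + - m * g x) by exact: in_L2_lin.
  have : 0 <= Gamma mu rho h (fun x => M * g x + -1 * f x)
                             (fun x => 1 * f x + - m * g x).
    apply: Gamma_synchronous_ge0 => //.
    rewrite (_ : (fun x => _ / h x) = (fun x => M * (g x / h x) - f x / h x));
      last by apply/funext => x; ring.
    rewrite (_ : (fun x => _ / h x) = (fun x => f x / h x - m * (g x / h x)));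
      last by apply/funext => x; ring.
    exact: sync.
  rewrite (Gamma_linl mrho rho_gt0 M (-1) hL gL fL vL).
  rewrite !(Gamma_linr mrho rho_gt0 1 (- m) hL fL gL) // (GammaC _ _ h g f).
  move: (Gamma _ _ _ f f) (Gamma _ _ _ f g) (Gamma _ _ _ g g) => A C B; lra.
(* With m = 3 and M = 23 the ratio of the coefficients is rational: up to a
   common factor, M g - f = 3 on {0} and f - m g = - 2 on {1}. *)
pose N := 8 / (1 - 4 * D).
have N_gt0 : 0 < N by rewrite divr_gt0 //; lra.
have ND : N * D = (N - 8) / 4 by rewrite /N; field; lra.
pose rho (n : nat) : R := if n is n'.+2 then N else 1.
pose f (n : nat) : R := if n is n'.+2 then 0 else if n is 1 then - 46 else 9.
pose g (n : nat) : R := if n is n'.+2 then 0 else if n is 1 then - 2 else 3.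
pose h (n : nat) : R := 1.
have Gff : Gamma (three_atoms R) rho h f f = 2197 * N + 3025.
  by rewrite GammaE /wdot !Rintegral_three_atoms /rho /f /h; ring.
have Ggg : Gamma (three_atoms R) rho h g g = 13 * N + 25.
  by rewrite GammaE /wdot !Rintegral_three_atoms /rho /g /h; ring.
have Gfg : Gamma (three_atoms R) rho h f g = 119 * N + 275.
  by rewrite GammaE /wdot !Rintegral_three_atoms /rho /f /g /h; ring.
exists _, nat, (three_atoms R), rho, 3, 23, f, g, h.
split; first by split => // -[|[|n]] //=.
split; first by rewrite ltr0n ltr_nat.
split; first by split; [|split]; exact: in_L2_three_atoms.
split; first by apply: aeW => x; rewrite /h oner_neq0.
split.
  (* The two functions are 60 on {0} and -40 on {1}, and 0 elsewhere; the product is 2400 when {x,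
     y} = {0, 1}, and 0 otherwise. *)
  apply: aeW => x; apply: aeW => y; rewrite /f /g /h.
  by case: x => [|[|x]]; case: y => [|[|y]]; lra.
rewrite {}Gff {}Ggg {}Gfg ger0_norm; last lra.
(* Only the leading term is kept: [2197 * 13 = 169^2]. *)
have sqrt_ge : 169 * N <= Num.sqrt (2197 * N + 3025) * Num.sqrt (13 * N + 25).
  rewrite -sqrtrM; last lra.
  rewrite -[leLHS]ger0_norm -?sqrtr_sqr; last lra.
  by apply: ler_wsqrtr; nra.
apply: lt_le_trans (lerB sqrt_ge (lexx _)).
have -> : D * ((23 - 3) ^+ 2 / (23 + 3)) * (13 * N + 25) =
  200 * (N * D) + 5000 / 13 * D by field.
(* Both sides have leading term [50 N]; what remains is [5000 / 13 * D - 400 < - 275], which follows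
   from [D < 1/4]. *)
rewrite ND; lra.
Qed.
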